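(* Let $1\le k\le n-2$ and let $G$ be a strongly connected simple digraph on $n$ vertices with arc connectivity $k$. Then: (i) for $\alpha=0$, $\lambda_\alpha(G)\le\lambda_\alpha(K(n,k,1))=\lambda_\alpha(K(n,k,n-k-1))$, with equality if and only if $G\cong K(n,k,n-k-1)$ or $G\cong K(n,k,1)$; (ii) for $0<\alpha<1$, $\lambda_\alpha(G)\le\lambda_\alpha(K(n,k,n-k-1))$, with equality if and only if $G\cong K(n,k,n-k-1)$.
   Context: For a simple digraph $G$, $A(G)$ is the adjacency matrix, $D(G)$ the diagonal matrix of outdegrees, $A_\alpha(G)=\alpha D(G)+(1-\alpha)A(G)$, and $\lambda_\alpha(G)$ is the largest modulus of the eigenvalues of $A_\alpha(G)$. Strongly connected: for every ordered pair of vertices there is a directed path from the first to the second. The arc connectivity of a strongly connected digraph is the minimum number of arcs whose deletion yields a digraph that is not strongly connected. $K(n,k,m)$ ($1\le m\le n-k-1$) is the digraph whose vertex set is partitioned into sets $S$, $V_1$, $V_2$ with $|S|=k$, $|V_1|=m$, $|V_2|=n-k-m$, and whose arcs are all ordered pairs $(u,v)$ of distinct vertices except those with $u\in V_2$ and $v\in V_1$. *)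

(* Defs.v *)
From HB Require Import structures.
From mathcomp Require Import all_boot all_order all_algebra.
From mathcomp Require Import all_classical all_reals.
From mathcomp Require Import complex.

Set Implicit Arguments.
Unset Strict Implicit.
Unset Printing Implicit Defensive.

Import Order.TTheory GRing.Theory Num.Theory.

Local Open Scope ring_scope.

Record digraph (n : nat) := Digraph {
  arc :> rel 'I_n;
  arc_irrefl : irreflexive arc }.

Definition digraph_iso (n : nat) (G H : digraph n) : Prop :=
  exists2 f : 'I_n -> 'I_n, bijective f & forall x y, H (f x) (f y) = G x y.

Definition strongly_connected (n : nat) (G : digraph n) : bool :=
  [forall x, forall y, connect G x y].

Definition arcs (n : nat) (G : digraph n) : {set 'I_n * 'I_n} :=
  [set a | G a.1 a.2].

Section DeleteArcs.
Variables (n : nat) (G : digraph n) (F : {set 'I_n * 'I_n}).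

Definition delete_arc : rel 'I_n := [rel x y | G x y && ((x, y) \notin F)].

Lemma delete_arc_irrefl : irreflexive delete_arc.
Proof. by move=> x; rewrite /delete_arc /= arc_irrefl. Qed.

Definition delete_arcs : digraph n := Digraph delete_arc_irrefl.
End DeleteArcs.

Definition arc_cut (n : nat) (G : digraph n) (F : {set 'I_n * 'I_n}) : bool :=
  (F \subset arcs G) && ~~ strongly_connected (delete_arcs G F).

(* The default [arcs G] of the arg min is an arc cut as soon as [1 < n];
   for [n <= 1] no arc cut exists and the value is 0. *)
Definition arc_connectivity (n : nat) (G : digraph n) : nat :=
  #|[arg min_(F < arcs G | arc_cut G F) #|F| ]|.

(* The vertices [0 .. k-1] form S, [k .. k+m-1] form V_1, and the rest V_2. *)
Section DigraphK.
Variables (n k m : nat).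

Definition K_V1 : {set 'I_n} := [set x : 'I_n | (k <= x < k + m)%N].
Definition K_V2 : {set 'I_n} := [set x : 'I_n | (k + m <= x)%N].

Definition K_arc : rel 'I_n :=
  [rel x y | (x != y) && ~~ ((x \in K_V2) && (y \in K_V1))].

Lemma K_arc_irrefl : irreflexive K_arc.
Proof. by move=> x; rewrite /K_arc /= eqxx. Qed.

Definition digraphK : digraph n := Digraph K_arc_irrefl.
End DigraphK.

Section AlphaMatrix.
Variables (R : realType) (n : nat).

Definition adjacency_mx (G : digraph n) : 'M[R]_n :=
  \matrix_(i, j) (G i j)%:R.

Definition outdegree (G : digraph n) (i : 'I_n) : nat := #|[set j | G i j]|.

Definition outdegree_mx (G : digraph n) : 'M[R]_n :=
  diag_mx (\row_i (outdegree G i)%:R).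

Definition alpha_mx (alpha : R) (G : digraph n) : 'M[R]_n :=
  alpha *: outdegree_mx G + (1 - alpha) *: adjacency_mx G.

Definition eigenvalue_moduli (A : 'M[R]_n) : set R :=
  [set Normc.normc z | z in
    [set z : R[i] | eigenvalue (map_mx (real_complex R) A) z]]%classic.

(* The set of moduli is finite, and nonempty when [0 < n], so that the
   supremum is then a maximum. *)
Definition spectral_radius (A : 'M[R]_n) : R := sup (eigenvalue_moduli A).

Definition lambda_alpha (alpha : R) (G : digraph n) : R :=
  spectral_radius (alpha_mx alpha G).
End AlphaMatrix.

(* Main.v *)
(** The arcs of a minimum arc cut can be covered by [k] vertices avoiding a
    suitable pair of non-adjacent vertices, one on each side; hence [G] is a
    spanning subdigraph of some [K(n,k,m)], with parts [V1] and [V2].  Instead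
    of the Perron vector of [K(n,k,m)], take the vector [x] equal to [1] off
    [V2] and to [1 - u / |V2|] on [V2], where [u] comes from the Perron vector
    of [K(n,k,n-k-1)], whose spectral radius is [rho].  Then
    [A_alpha(G) x <= rho x] entrywise, with equality if and only if [G] is the
    whole of [K(n,k,m)] and [(|V2| - 1)(m - 1 + alpha u) = 0].  Pairing with
    the moduli of a left eigenvector bounds the spectral radius by [rho], and
    strictly so when the inequality is strict somewhere and [G] is strongly
    connected. *)
Require Import Defs.
From mathcomp Require Import all_classical all_reals complex.
From mathcomp Require Import all_fingroup all_boot all_order all_algebra.
From mathcomp Require Import ring lra zify.

Set Implicit Arguments.
Unset Strict Implicit.
Unset Printing Implicit Defensive.

Import Order.TTheory GRing.Theory Num.Theory.
Local Open Scope ring_scope.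

(** * Spectral radii of nonnegative matrices *)

(** Eigenvectors of [eigenvalue] are row vectors, whereas the test vector below is a column;
    transposing bridges the two. *)
Lemma char_poly_tr (F : comNzRingType) (n : nat) (A : 'M[F]_n) :
  char_poly A^T = char_poly A.
Proof.
by rewrite /char_poly -det_tr /char_poly_mx linearB /= tr_scalar_mx map_trmx trmxK.
Qed.

Section SpectralRadius.
Variable R : realType.
Local Notation normc := (@Normc.normc R).

Lemma normc_ge0 (z : R[i]) : 0 <= normc z.
Proof. by case: z => a b; apply: sqrtr_ge0. Qed.

Lemma normc_real (r : R) : normc (r%:C)%C = `|r|.
Proof. by rewrite /Normc.normc /= expr0n addr0 sqrtr_sqr. Qed.

Lemma normc_sum (I : finType) (F : I -> R[i]) :
  normc (\sum_i F i) <= \sum_i normc (F i).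
Proof.
apply: (big_ind2 (fun z r => normc z <= r)) => //.
- by rewrite Normc.normc0.
- by move=> z r w s zr ws; apply: le_trans (le_normcD _ _) (lerD zr ws).
Qed.

Lemma sum_nneg_eq0 (I : finType) (F : I -> R) :
  (forall i, 0 <= F i) -> \sum_i F i = 0 -> forall i, F i = 0.
Proof. by move=> F0 /psumr_eq0P sum0 i; apply: sum0. Qed.

Variable n : nat.
Implicit Types (A : 'M[R]_n) (x : 'I_n -> R) (r : R) (z : R[i]).

Local Notation eigenval A := (eigenvalue (map_mx (real_complex R) A)).

(** The characteristic polynomial splits over [R[i]] and has positive degree, so the eigenvalues
    form a finite nonempty list and the supremum is attained. *)
Lemma spectral_radius_max A : (0 < n)%N ->
  exists2 z, eigenval A z & spectral_radius A = normc z
    /\ forall w, eigenval A w -> normc w <= normc z.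
Proof.
move=> n_gt0; set p := char_poly (map_mx (real_complex R) A).
have [rs def_p] := closed_field_poly_normal p.
have rootsE w : eigenval A w = (w \in rs).
  rewrite eigenvalue_root_char -/p def_p rootZ ?root_prod_XsubC //.
  by rewrite (monicP (char_poly_monic _)) oner_neq0.
have rs_neq0 : rs != [::].
  apply/negP => /eqP rs0; have := size_char_poly (map_mx (real_complex R) A).
  rewrite -/p def_p rs0 big_nil (monicP (char_poly_monic _)) scale1r size_poly1.
  by case: n n_gt0.
have [z zrs zmax] : exists2 z, z \in rs & forall w, w \in rs -> normc w <= normc z.
  elim: rs rs_neq0 {def_p rootsE} => // w [|w' rs] IH _.
    by exists w; rewrite ?mem_head // => v; rewrite inE => /eqP->.
  have [//|z zrs zmax] := IH.
  have [zw|wz] := leP (normc z) (normc w).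
    exists w; first exact: mem_head.
    by move=> v; rewrite inE => /orP[/eqP->|/zmax/le_trans]//; apply.
  exists z; first by rewrite inE zrs orbT.
  by move=> v; rewrite inE => /orP[/eqP->|/zmax]//; exact: ltW.
have zmax' w : eigenval A w -> normc w <= normc z by rewrite rootsE; exact: zmax.
exists z; rewrite ?rootsE //; split=> //.
have ubz : ubound (eigenvalue_moduli A) (normc z).
  by move=> _ [w /= ew <-]; exact: zmax'.
have zin : eigenvalue_moduli A (normc z) by exists z; rewrite //= rootsE.
apply/le_anti/andP; split; first by apply: ge_sup => //; exists (normc z).
by apply: ub_le_sup => //; exists (normc z).
Qed.

Definition nonneg_mx A := forall i j, 0 <= A i j.

(* Pairing with the moduli of a left eigenvector [v] turns the entrywise
   inequality [A x <= r x] into a scalar one. *)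
Lemma left_eigenvector_pairing A x r z (v : 'rV[R[i]]_n) :
  nonneg_mx A -> (forall i, 0 < x i) ->
  (forall i, \sum_j A i j * x j <= r * x i) ->
  v *m map_mx (real_complex R) A = z *: v ->
  [/\ forall j, normc z * normc (v 0 j) <= \sum_i normc (v 0 i) * A i j,
      \sum_j normc z * normc (v 0 j) * x j
        <= \sum_j (\sum_i normc (v 0 i) * A i j) * x j,
      \sum_j (\sum_i normc (v 0 i) * A i j) * x j
        = \sum_i normc (v 0 i) * \sum_j A i j * x j &
      \sum_i normc (v 0 i) * (\sum_j A i j * x j)
        <= \sum_i normc (v 0 i) * (r * x i)].
Proof.
move=> A0 x0 Ax vA.
have col j : normc z * normc (v 0 j) <= \sum_i normc (v 0 i) * A i j.
  rewrite -Normc.normcM; have /rowP/(_ j) := vA; rewrite !mxE => <-.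
  apply: le_trans (normc_sum _) _; apply: ler_sum => i _.
  by rewrite Normc.normcM mxE normc_real ger0_norm.
split=> //.
- by apply: ler_sum => j _; rewrite ler_pM2r.
- under eq_bigr do rewrite mulr_suml.
  rewrite exchange_big; apply: eq_bigr => i _; rewrite mulr_sumr.
  by apply: eq_bigr => j _; rewrite mulrA.
- by apply: ler_sum => i _; rewrite ler_wpM2l // normc_ge0.
Qed.

(** The pairing chain reads [normc z * W <= r * W] with [W] the sum of [normc (v 0 j) * x j], and
    [W > 0] because [v] is nonzero and [x] positive. *)
Lemma eigenvalue_le_supersolution A x r z :
  nonneg_mx A -> (forall i, 0 < x i) ->
  (forall i, \sum_j A i j * x j <= r * x i) ->
  eigenval A z -> normc z <= r.
Proof.
move=> A0 x0 Ax /eigenvalueP[v vA v0].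
have [_ le1 eq2 le3] := left_eigenvector_pairing A0 x0 Ax vA.
rewrite eq2 in le1; have := le_trans le1 le3.
under eq_bigr do rewrite -mulrA.
under [X in _ <= X]eq_bigr do rewrite mulrCA.
rewrite -!mulr_sumr ler_pM2r // lt0r sumr_ge0 ?andbT; last first.
  by move=> j _; rewrite mulr_ge0 ?normc_ge0 ?ltW.
apply: contra_neq v0 => sum0; apply/rowP => j; rewrite mxE.
have /eqP := sum_nneg_eq0 (fun j => mulr_ge0 (normc_ge0 _) (ltW (x0 j))) sum0 j.
by rewrite mulf_eq0 (gt_eqF (x0 j)) orbF // => /eqP; exact: Normc.eq0_normc.
Qed.

Lemma spectral_radius_le A x r : (0 < n)%N ->
  nonneg_mx A -> (forall i, 0 < x i) ->
  (forall i, \sum_j A i j * x j <= r * x i) ->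
  spectral_radius A <= r.
Proof.
move=> n0 A0 x0 Ax; have [z Az [-> _]] := spectral_radius_max A n0.
exact: eigenvalue_le_supersolution Az.
Qed.

(** The upper bound is the supersolution bound; for the lower one, [r] is itself an eigenvalue, with
    eigenvector [x]. *)
Lemma spectral_radius_eq A x r : (0 < n)%N ->
  nonneg_mx A -> (forall i, 0 < x i) -> 0 <= r ->
  (forall i, \sum_j A i j * x j = r * x i) ->
  spectral_radius A = r.
Proof.
move=> n0 A0 x0 r0 Ax.
have [z Az [-> zmax]] := spectral_radius_max A n0.
apply/le_anti/andP; split.
  by apply: eigenvalue_le_supersolution Az => // i; rewrite Ax.
rewrite -[r]ger0_norm // -normc_real; apply: zmax.
rewrite eigenvalue_map eigenvalue_root_char -char_poly_tr -eigenvalue_root_char.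
apply/eigenvalueP; exists (\row_i x i).
  apply/rowP => i; rewrite !mxE -Ax; apply: eq_bigr => j _.
  by rewrite !mxE mulrC.
case: n n0 x x0 {A A0 Ax z Az} => // n' _ x x0.
by apply/negP => /eqP/rowP/(_ 0); rewrite !mxE => /eqP; rewrite gt_eqF.
Qed.

(** When [normc z = r] the two ends of the pairing chain agree, so every inequality in it is an
    equality. Irreducibility makes the left eigenvector nowhere zero, and equality of the weighted
    sums then forces equality in each row. *)
Lemma spectral_radius_eq_inv A x r : (0 < n)%N ->
  nonneg_mx A -> (forall i, 0 < x i) ->
  (forall i, \sum_j A i j * x j <= r * x i) ->
  (forall i j, connect [rel a b | A a b != 0] i j) ->
  spectral_radius A = r -> forall i, \sum_j A i j * x j = r * x i.
Proof.
move=> n0 A0 x0 Ax conA.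
have [z /eigenvalueP[v vA v0] [-> _]] := spectral_radius_max A n0 => zr.
have [col le1 eq2 le3] := left_eigenvector_pairing A0 x0 Ax vA.
have eq03 : \sum_j normc z * normc (v 0 j) * x j
    = \sum_i normc (v 0 i) * (r * x i).
  by apply: eq_bigr => i _; rewrite zr; ring.
have /eqP e1 : \sum_j normc z * normc (v 0 j) * x j
    == \sum_j (\sum_i normc (v 0 i) * A i j) * x j.
  by rewrite eq_le le1 eq03 eq2 le3.
have /eqP e3 : \sum_i normc (v 0 i) * (r * x i)
    == \sum_i normc (v 0 i) * \sum_j A i j * x j.
  by rewrite -eq03 e1 eq2.
(* Equality in column [j] makes a sum of nonnegative terms vanish, so zeros of [v] propagate
   backwards along nonzero entries. *)
have pred0 i j : v 0 j = 0 -> A i j != 0 -> v 0 i = 0.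
  move=> vj0 Aij.
  have : \sum_j ((\sum_i normc (v 0 i) * A i j) * x j
      - normc z * normc (v 0 j) * x j) = 0 by rewrite sumrB e1 subrr.
  move=> /sum_nneg_eq0-/(_ _ j)/eqP.
  rewrite vj0 Normc.normc0 mulr0 mul0r subr0 mulf_eq0 (gt_eqF (x0 j)) orbF.
  move=> H; have {}H : \sum_i normc (v 0 i) * A i j = 0.
    by apply/eqP/H => a; rewrite -mulrBl mulr_ge0 ?subr_ge0 // ltW.
  have /eqP := sum_nneg_eq0 (fun a => mulr_ge0 (normc_ge0 _) (A0 a j)) H i.
  by rewrite mulf_eq0 (negPf Aij) orbF => /eqP; exact: Normc.eq0_normc.
have vn0 i : v 0 i != 0.
  apply: contra_neq v0 => vi0; apply/rowP => j; rewrite mxE.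
  have /connectP[p] := conA j i.
  elim: p j => [|b p IH] j /=; first by move=> _ <-.
  by move=> /andP[/pred0 Ajb pp] def_i; apply: Ajb; apply: IH.
move=> i; have : \sum_i normc (v 0 i) * (r * x i - \sum_j A i j * x j) = 0.
  by under eq_bigr do rewrite mulrBr; rewrite sumrB e3 subrr.
move=> /sum_nneg_eq0-/(_ _ i)/eqP; rewrite mulf_eq0 subr_eq0.
have -> : (normc (v 0 i) == 0) = false.
  by apply: contraNF (vn0 i) => /eqP/Normc.eq0_normc/eqP.
move=> H; apply/esym/eqP/H => a.
by rewrite mulr_ge0 ?normc_ge0 ?subr_ge0.
Qed.

End SpectralRadius.

(** * From arc cuts to the digraphs K(n,k,m) *)

Lemma arc_connectivity_cut (n : nat) (G : digraph n) : (1 < n)%N ->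
  exists2 F : {set _}, arc_cut G F & #|F| = arc_connectivity G.
Proof.
move=> n1; rewrite /arc_connectivity; case: arg_minnP => [|F cutF _]; last first.
  by exists F.
(* The default value is a cut: with all arcs deleted, no path leads from vertex 0 to vertex 1. *)
rewrite /arc_cut subxx /=; apply/forallP => /(_ (Ordinal (ltnW n1))).
move=> /forallP/(_ (Ordinal n1))/connectP[[|y p] //=].
by rewrite /delete_arc /= inE /= andbN.
Qed.

Definition separation (n : nat) (G : digraph n) (V1 V2 : {set 'I_n}) : Prop :=
  forall x y, x \in V2 -> y \in V1 -> ~~ G x y.

Lemma extend_card (T : finType) (A B : {set T}) (k : nat) :
  A \subset B -> (#|A| <= k <= #|B|)%N ->
  exists C : {set T}, [/\ A \subset C, C \subset B & #|C| = k].
Proof.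
move=> sAB /andP[Ak kB]; have [d def_k] : exists d, k = (#|A| + d)%N.
  by exists (k - #|A|)%N; rewrite subnKC.
elim: d k def_k kB {Ak} => [|d IH] k def_k kB.
  by exists A; rewrite def_k addn0; split.
have [||C [sAC sCB cardC]] := IH (#|A| + d)%N; rewrite ?def_k //.
  by move: kB; rewrite def_k addnS => /ltnW.
have [x xB xC] : exists2 x, x \in B & x \notin C.
  apply/subsetPn; apply: contraTN kB => /subset_leq_card.
  by rewrite def_k cardC -ltnNge addnS.
exists (x |: C); split; first exact: (subset_trans sAC (subsetUr _ _)).
  by rewrite subUset sub1set xB.
by rewrite cardsU1 xC cardC addnS.
Qed.

(* Every arc leaving the tail side [X] of a minimum arc cut is covered by one
   of its endpoints, chosen to avoid a fixed non-adjacent pair [x0], [y0]. *)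
Lemma separation_of_arc_connectivity (n k : nat) (G : digraph n) :
  (k <= n - 2)%N -> (2 <= n)%N -> arc_connectivity G = k ->
  exists V1 V2 : {set 'I_n},
    [/\ [disjoint V1 & V2], (0 < #|V1|)%N, (0 < #|V2|)%N,
        (k + #|V1| + #|V2| = n)%N & separation G V1 V2].
Proof.
move=> kn n2 Gk; have [F /andP[_ /forallPn[a /forallPn[b ab]]] cardF] :=
  arc_connectivity_cut G n2.
rewrite Gk in cardF.
pose X := [set x | connect (delete_arcs G F) a x].
have outF x y : x \in X -> y \notin X -> G x y -> (x, y) \in F.
  rewrite !inE => ax ay Gxy; apply: contraNT ay => xyF.
  by apply: connect_trans ax (connect1 _); rewrite /= /delete_arc /= Gxy.
(* Both sides are nonempty and their sizes add up to [n], so there are at least [n - 1 > k] pairs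
   from [X] to its complement, too many for [F]. *)
have [[x0 y0] /setXP[/= x0X y0X] G0] : exists2 p, p \in setX X (~: X) & p \notin F.
  apply/subsetPn; apply/negP => /subset_leq_card.
  have a_in : (0 < #|X|)%N by apply/card_gt0P; exists a; rewrite inE.
  have b_in : (0 < #|~: X|)%N by apply/card_gt0P; exists b; rewrite !inE.
  rewrite cardsX cardF; have := cardsC X; rewrite card_ord.
  nia.
rewrite inE in y0X.
(* Cover an arc by its tail, or by its head if the tail is [x0]. For an arc of [F] from [X] to its
   complement this is never [x0] or [y0], since [(x0, y0)] is not in [F]. *)
pose c p := if p.1 == x0 then p.2 else p.1 : 'I_n.
(* Other arcs of [F] could still be sent to [y0]. The set may have fewer than [k] elements and is
   padded to [C], which plays the role of S. *)
pose S0 := (c @: F) :\: [set x0; y0].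
have [C [sS0C sC cardC]] : exists C : {set 'I_n},
    [/\ S0 \subset C, C \subset ~: [set x0; y0] & #|C| = k].
  apply: extend_card; first by rewrite /S0 setDE subsetIr.
  have x0y0 : x0 != y0 by apply: contraNneq y0X => <-.
  have := cardsC [set x0; y0]; rewrite cards2 x0y0 card_ord => cardxy.
  apply/andP; split; last by rewrite -(leq_add2l 2) cardxy; lia.
  apply: leq_trans (subset_leq_card (subsetDl _ _)) _.
  by rewrite -cardF leq_imset_card.
have x0C : x0 \notin C.
  by apply: contraL x0X => /(subsetP sC); rewrite !inE eqxx.
have y0C : y0 \notin C.
  by apply/negP => /(subsetP sC); rewrite !inE eqxx orbT.
exists (~: X :\: C), (X :\: C); split.
- rewrite -setI_eq0; apply/eqP/setP => x; rewrite !inE.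
  by case: (connect _ a x); rewrite !andbF.
- by apply/card_gt0P; exists y0; rewrite in_setD y0C in_setC y0X.
- by apply/card_gt0P; exists x0; rewrite inE x0C.
- have -> : #|~: X :\: C| = #|~: C :\: X|.
    by apply: eq_card => x; rewrite !inE andbC.
  have -> : #|X :\: C| = #|~: C :&: X|.
    by apply: eq_card => x; rewrite !inE.
  by rewrite -addnA [(#|_ :\: X| + _)%N]addnC cardsID -cardC cardsC card_ord.
move=> x y; rewrite !inE => /andP[xC ax] /andP[yC ay]; apply/negP => Gxy.
have xyF : (x, y) \in F by apply: outF; rewrite ?inE.
have: c (x, y) \in C.
  apply: (subsetP sS0C); rewrite !inE imset_f ?andbT // /c /=.
  have [xx0|xx0] := eqVneq x x0.
    rewrite negb_or; apply/andP; split.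
      by apply: contraNneq ay => ->; move: x0X; rewrite inE.
    by apply: contraNneq G0 => <-; rewrite -xx0.
  rewrite (negPf xx0) /=; apply: contraNneq y0X => <-.
  by rewrite inE.
by rewrite /c /=; case: ifP => _; apply/negP.
Qed.

(** K(n,k,m) on arbitrary parts, S being what they leave out; isomorphism with [digraphK] then
    reduces to comparing cardinals. *)
Definition K_form (n : nat) (V1 V2 : {set 'I_n}) (G : digraph n) : Prop :=
  forall x y, G x y = (x != y) && ~~ ((x \in V2) && (y \in V1)).

Lemma K_form_digraphK (n k m : nat) :
  K_form (K_V1 n k m) (K_V2 n k m) (digraphK n k m).
Proof. by []. Qed.

Lemma card_ord_interval (n a b : nat) :
  #|[set x : 'I_n | (a <= x < b)%N]| = (minn b n - a)%N.
Proof.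
rewrite cardsE cardE /enum_mem size_filter -enumT.
have -> : count (mem (fun x : 'I_n => (a <= x < b)%N)) (enum 'I_n)
    = count (fun i : nat => (a <= i < b)%N) (iota 0 n).
  by rewrite -val_enum_ord count_map.
elim: n => [|n IH]; first by rewrite minn0.
by rewrite -addn1 iotaD count_cat IH /= addn0; lia.
Qed.

Lemma card_K_V1 (n k m : nat) : (k + m <= n)%N -> #|K_V1 n k m| = m.
Proof. by move=> kmn; rewrite card_ord_interval; lia. Qed.

Lemma card_K_V2 (n k m : nat) : #|K_V2 n k m| = (n - (k + m))%N.
Proof.
rewrite -[n in RHS]minnn -card_ord_interval; apply: eq_card => x.
by rewrite !inE ltn_ord andbT.
Qed.

Lemma disjoint_K_V12 (n k m : nat) : [disjoint K_V1 n k m & K_V2 n k m].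
Proof.
rewrite -setI_eq0; apply/eqP/setP => x; rewrite !inE.
by apply/negP => /andP[/andP[_]]; rewrite ltnNge => /negP.
Qed.

(** Equal class sizes make the two tuples of colours permutations of each other. The colour of a
    vertex will be its membership in the two parts. *)
Lemma recolor (n : nat) (T : finType) (c d : 'I_n -> T) :
  (forall v, #|[set x | c x == v]| = #|[set x | d x == v]|) ->
  exists p : {perm 'I_n}, forall x, d (p x) = c x.
Proof.
move=> cd; have /tuple_permP[p def_c] :
    perm_eq [tuple c i | i < n] [tuple d i | i < n].
  rewrite /= /perm_eq; apply/allP => v _ /=.
  have count_color e : count_mem v [seq e i | i : 'I_n] = #|[set x | e x == v]|.
    rewrite /image_mem count_map cardsE cardE /enum_mem size_filter -enumT.
    by rewrite count_filter; apply: eq_count => x; rewrite !inE andbT.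
  by rewrite !count_color cd.
exists p => x; have := congr1 (fun t => nth (c x) t x) def_c.
by rewrite -!tnth_nth !tnth_mktuple => ->.
Qed.

Lemma card_color (n : nat) (V1 V2 : {set 'I_n}) (v : bool * bool) :
  [disjoint V1 & V2] ->
  #|[set x | (x \in V1, x \in V2) == v]| =
    (if v.1 then if v.2 then 0 else #|V1|
     else if v.2 then #|V2| else n - (#|V1| + #|V2|))%N.
Proof.
move=> dis; have disF x : x \in V1 -> (x \in V2) = false by move/(disjointFr dis).
case: v => [[] []] /=.
- apply: eq_card0 => x; rewrite !inE xpair_eqE !eqb_id.
  by apply/andP => -[/disF->].
- apply: eq_card => x; rewrite !inE xpair_eqE eqb_id eqbF_neg.
  by case xV: (x \in V1); rewrite //= disF.
- apply: eq_card => x; rewrite !inE xpair_eqE eqb_id eqbF_neg.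
  by case xV: (x \in V1); rewrite //= disF.
have <- : #|V1 :|: V2| = (#|V1| + #|V2|)%N.
  by apply/eqP; rewrite (leq_card_setU V1 V2).2.
have := cardsCs (~: (V1 :|: V2)); rewrite setCK card_ord => <-; apply: eq_card => x.
by rewrite !inE xpair_eqE !eqbF_neg negb_or.
Qed.

(** Arcs between distinct vertices depend only on the colours of their ends, so a permutation
    respecting colours is an isomorphism. *)
Lemma K_form_iso (n : nat) (V1 V2 W1 W2 : {set 'I_n}) (G H : digraph n) :
  [disjoint V1 & V2] -> [disjoint W1 & W2] ->
  #|V1| = #|W1| -> #|V2| = #|W2| ->
  K_form V1 V2 G -> K_form W1 W2 H -> digraph_iso G H.
Proof.
move=> disV disW c1 c2 formG formH.
have [v|p pV] := @recolor n _ (fun x => (x \in V1, x \in V2))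
                           (fun x => (x \in W1, x \in W2)).
  by rewrite !card_color // c1 c2.
exists p; first by exists (perm_inv p); [exact: permK | exact: permKV].
move=> x y; rewrite formG formH (inj_eq perm_inj).
by have [_ ->] := pV x; have [-> _] := pV y.
Qed.

Lemma iso_K_form (n : nat) (W1 W2 : {set 'I_n}) (G H : digraph n) :
  [disjoint W1 & W2] -> digraph_iso G H -> K_form W1 W2 H ->
  exists V1 V2 : {set 'I_n}, [/\ [disjoint V1 & V2], #|V1| = #|W1|,
    #|V2| = #|W2| & K_form V1 V2 G].
Proof.
move=> dis [f bijf fGH] formH.
have cardf (W : {set 'I_n}) : #|f @^-1: W| = #|W|.
  exact: card_preimset (bij_inj bijf).
exists (f @^-1: W1), (f @^-1: W2); split; rewrite ?cardf //.
  rewrite -setI_eq0 -preimsetI; move: dis; rewrite -setI_eq0 => /eqP->.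
  by rewrite preimset0.
by move=> x y; rewrite -fGH formH (inj_eq (bij_inj bijf)) !inE.
Qed.

(** * The test vector *)

(** The diagonal term is spread over the out-arcs, one [alpha * x i] each. For positive [x] and
    [0 <= alpha < 1] every arc then contributes positively, so adding arcs increases the row sum. *)
Lemma alpha_mx_row (R : realType) (n : nat) (alpha : R) (G : digraph n)
    (x : 'I_n -> R) (i : 'I_n) :
  \sum_j alpha_mx alpha G i j * x j
    = \sum_(j | G i j) (alpha * x i + (1 - alpha) * x j).
Proof.
rewrite big_split /= sumr_const -mulr_natr.
have -> : #|[pred j | G i j]|%:R = (outdegree G i)%:R :> R.
  by congr _%:R; apply: eq_card => j; rewrite !inE.
rewrite [X in _ + X]big_mkcond /=.
under eq_bigr => j _ do rewrite !mxE mulrDl.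
rewrite big_split /= (bigD1 i) //= eqxx mulr1n big1 ?addr0; last first.
  by move=> j ji; rewrite eq_sym (negPf ji) mulr0n mulr0 mul0r.
congr (_ + _); first by ring.
by apply: eq_bigr => j _; case: (G i j); rewrite ?mulr1 // mulr0 mul0r.
Qed.

Lemma sum_pred_le (R : realType) (I : finType) (P Q : pred I) (F : I -> R) :
  (forall i, 0 < F i) -> subpred P Q ->
  \sum_(i | P i) F i <= \sum_(i | Q i) F i
    ?= iff [forall i, P i == Q i].
Proof.
move=> F0 sPQ; rewrite [X in _ <= X ?= iff _](bigID P) /=.
rewrite [X in _ <= X + _ ?= iff _](_ : _ = \sum_(i | P i) F i); last first.
  apply: eq_bigl => i; case Pi: (P i); rewrite ?andbF // andbT.
  exact: sPQ.
have D0 : 0 <= \sum_(i | Q i && ~~ P i) F i by apply: sumr_ge0 => i _; apply: ltW.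
split; first by rewrite lerDl.
rewrite -subr_eq0 opprD addrA subrr add0r oppr_eq0.
apply/eqP/forallP => [sum0 i|PQ]; last first.
  by rewrite big1 // => i; rewrite -(eqP (PQ i)) andbN.
apply/eqP; case Pi: (P i); first by rewrite sPQ.
apply/esym/negbTE/negP => Qi; have := psumr_eq0P _ sum0.
move=> /(_ (fun i _ => ltW (F0 i)) i); rewrite Qi Pi => /(_ isT)/eqP.
by rewrite gt_eqF.
Qed.

(* For [|V2| = 1] this is the Perron vector of [K(n,k,n-k-1)], of eigenvalue
   [n - 1 - (1 - alpha) u], when [u] is as in [rate_exists]; the division by
   [|V2|] keeps the row sums outside [V2] independent of [V2]. *)
Definition test_vector (R : realType) (n : nat) (u : R) (V2 : {set 'I_n})
  (i : 'I_n) : R := 1 - (i \in V2)%:R * (u / #|V2|%:R).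

Section TestVector.
Variables (R : realType) (n k : nat) (alpha u : R) (V1 V2 : {set 'I_n}).
Hypotheses (alpha_ge0 : 0 <= alpha) (alpha_lt1 : alpha < 1).
Hypotheses (u_gt0 : 0 < u) (u_lt1 : u < 1).
(** For K(n,k,n-k-1) and the vector [1 - u] on the single vertex of V2, [1] elsewhere, this is the
    eigenvalue equation in the row of that vertex, whose outdegree is [k]; the other rows give the
    eigenvalue [rho]. *)
Hypothesis u_root :
  (n%:R - 1 - (1 - alpha) * u - alpha * k%:R) * (1 - u) = (1 - alpha) * k%:R.
Hypothesis disV : [disjoint V1 & V2].
Hypothesis V1_gt0 : (0 < #|V1|)%N.
Hypothesis V2_gt0 : (0 < #|V2|)%N.
Hypothesis cardV : (k + #|V1| + #|V2| = n)%N.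

Local Notation rho := (n%:R - 1 - (1 - alpha) * u).
Local Notation x := (test_vector u V2).
Local Notation gap := ((#|V2|%:R - 1) * (#|V1|%:R - 1 + alpha * u)).

Lemma V2R_ge1 : 1 <= #|V2|%:R :> R. Proof. by rewrite ler1n. Qed.
Lemma V1R_ge1 : 1 <= #|V1|%:R :> R. Proof. by rewrite ler1n. Qed.
Lemma V2R_neq0 : #|V2|%:R != 0 :> R. Proof. by rewrite pnatr_eq0 -lt0n. Qed.
Lemma orderE : n%:R = k%:R + #|V1|%:R + #|V2|%:R :> R.
Proof. by rewrite -!natrD cardV. Qed.
Lemma order_gt0 : (0 < n)%N. Proof. by rewrite -cardV addn_gt0 V2_gt0 orbT. Qed.

Lemma test_vector_gt0 i : 0 < x i.
Proof.
rewrite subr_gt0; case: (i \in V2); rewrite ?mul0r // mul1r.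
by rewrite ltr_pdivrMr ?mul1r ?(lt_le_trans _ V2R_ge1).
Qed.

Lemma row_term_gt0 i j : 0 < alpha * x i + (1 - alpha) * x j.
Proof.
have alpha' : 0 < 1 - alpha by rewrite subr_gt0.
apply: ltr_wpDl (mulr_gt0 alpha' (test_vector_gt0 j)).
exact: mulr_ge0 alpha_ge0 (ltW (test_vector_gt0 i)).
Qed.

Lemma row_gap_ge0 : 0 <= gap.
Proof.
rewrite mulr_ge0 ?subr_ge0 ?V2R_ge1 // addr_ge0 ?subr_ge0 ?V1R_ge1 //.
exact: mulr_ge0 alpha_ge0 (ltW u_gt0).
Qed.

(** The entries of [x] over any [P] containing [V2] add up to [#|P| - u], whatever the size of [V2].
    It serves for [P] the whole vertex set and for [P] the complement of [V1]. *)
Lemma sum_row_terms (P : {set 'I_n}) (i : 'I_n) : V2 \subset P -> i \in P ->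
  \sum_(j in P | j != i) (alpha * x i + (1 - alpha) * x j)
    = alpha * x i * (#|P|%:R - 1) + (1 - alpha) * (#|P|%:R - u - x i).
Proof.
move=> sVP iP.
have sumP : \sum_(j in P) x j = #|P|%:R - u.
  rewrite (_ : \sum_(j in P) x j = \sum_(j in P) 1
      - (\sum_(j in P) (j \in V2)%:R) * (u / #|V2|%:R)); last first.
    by rewrite mulr_suml -sumrB.
  rewrite sumr_const; congr (_ - _).
  rewrite -natr_sum; have -> : (\sum_(j in P) (j \in V2))%N = #|V2|.
    rewrite -sum1_card big_mkcond [RHS]big_mkcond; apply: eq_bigr => j _.
    by have := subsetP sVP j; case: (j \in V2) => [->|_] //; case: ifP.
  by rewrite mulrCA divff ?mulr1 // V2R_neq0.
have : \sum_(j in P) (alpha * x i + (1 - alpha) * x j)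
    = alpha * x i * #|P|%:R + (1 - alpha) * (#|P|%:R - u).
  by rewrite big_split /= sumr_const -mulr_sumr sumP mulr_natr.
rewrite (bigD1 i) //= => /(canRL (addKr _)) ->; ring.
Qed.

(** Rows outside [V2] give [rho] by the choice of [rho]; a row in [V2] falls short by [gap / #|V2|],
    by [u_root]. *)
Lemma K_form_row (i : 'I_n) :
  \sum_(j | (i != j) && ~~ ((i \in V2) && (j \in V1)))
      (alpha * x i + (1 - alpha) * x j)
    = rho * x i - (i \in V2)%:R * (gap / #|V2|%:R).
Proof.
have [iV2|iV2] /= := boolP (i \in V2); last first.
  rewrite (eq_bigl (fun j => (j \in [set: 'I_n]) && (j != i))); last first.
    by move=> j; rewrite inE andbT eq_sym.
  rewrite sum_row_terms ?inE ?subsetT // cardsT card_ord /test_vector (negPf iV2).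
  by rewrite !mulr0n; ring.
rewrite (eq_bigl (fun j => (j \in ~: V1) && (j != i))); last first.
  by move=> j; rewrite inE andbC eq_sym.
have iV1 : i \notin V1 by rewrite (disjointFl disV iV2).
rewrite sum_row_terms ?inE //; last first.
  by rewrite -disjoints_subset disjoint_sym.
have -> : #|~: V1|%:R = k%:R + #|V2|%:R :> R.
  rewrite -natrD; congr _%:R; have := cardsC V1; rewrite card_ord; lia.
rewrite /test_vector iV2 mul1r; apply: (mulIf V2R_neq0).
move: u_root; rewrite orderE; move: V2R_neq0.
move: (#|V2|%:R) (#|V1|%:R) (k%:R) => b m q b0 uE.
(* After multiplication by [#|V2|], the two sides differ exactly by the difference of the sides of
   [u_root]. *)
apply/eqP; rewrite -subr_eq0.
rewrite (_ : _ - _ = (1 - alpha) * q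
    - (q + m + b - 1 - (1 - alpha) * u - alpha * q) * (1 - u)); last by field.
by rewrite uE subrr.
Qed.

Lemma separation_row (G : digraph n) i : separation G V1 V2 ->
  \sum_j alpha_mx alpha G i j * x j
    <= \sum_(j | (i != j) && ~~ ((i \in V2) && (j \in V1)))
          (alpha * x i + (1 - alpha) * x j)
    ?= iff [forall j, G i j == (i != j) && ~~ ((i \in V2) && (j \in V1))].
Proof.
move=> sep; rewrite alpha_mx_row; apply: sum_pred_le => [j|j Gij].
  exact: row_term_gt0.
apply/andP; split; first by apply: contraTneq Gij => <-; rewrite arc_irrefl.
by apply: contraL Gij => /andP[iV2 jV1]; apply: sep.
Qed.

Lemma alpha_mx_nonneg (G : digraph n) : nonneg_mx (alpha_mx alpha G).
Proof.
move=> i j; rewrite !mxE addr_ge0 ?mulr_ge0 ?ler0n ?subr_ge0 ?(ltW alpha_lt1) //.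
by rewrite mulrn_wge0.
Qed.

Lemma separation_row_le (G : digraph n) : separation G V1 V2 ->
  forall i, \sum_j alpha_mx alpha G i j * x j <= rho * x i.
Proof.
move=> sep i; apply: le_trans (separation_row i sep).1 _; rewrite K_form_row gerBl.
by rewrite mulr_ge0 // divr_ge0 // row_gap_ge0.
Qed.

Lemma lambda_alpha_separation_le (G : digraph n) : separation G V1 V2 ->
  lambda_alpha alpha G <= rho.
Proof.
move=> sep.
apply: (spectral_radius_le order_gt0 (alpha_mx_nonneg G) test_vector_gt0).
exact: separation_row_le.
Qed.

Lemma lambda_alpha_separation_eq (G : digraph n) : separation G V1 V2 ->
  strongly_connected G -> lambda_alpha alpha G = rho ->
  K_form V1 V2 G /\ gap = 0.
Proof.
move=> sep conG lamE.
move: lamE => /(spectral_radius_eq_inv order_gt0 (alpha_mx_nonneg G)).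
move=> /(_ _ test_vector_gt0 (separation_row_le sep)) rowE.
(* Entries on arcs are at least [1 - alpha > 0], so strong connectivity of [G] gives
   irreducibility. *)
have {}rowE i : \sum_j alpha_mx alpha G i j * x j = rho * x i.
  apply: rowE => a b; move: (forallP (forallP conG a) b).
  apply: connect_sub => c d Gcd; apply: connect1; rewrite /= !mxE Gcd mulr1.
  rewrite gt_eqF // ltr_wpDl ?subr_gt0 // mulr_ge0 // mulrn_wge0 //.
(* The row of [G] equals [rho * x i] but is at most the row of the full K-form, which is [rho * x i]
   minus this nonnegative term. *)
have gapE i : (i \in V2)%:R * (gap / #|V2|%:R) = 0.
  apply/le_anti; rewrite mulr_ge0 ?divr_ge0 ?row_gap_ge0 // andbT.
  by have := (separation_row i sep).1; rewrite rowE K_form_row lerDl oppr_ge0.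
split.
  move=> i j; have := (separation_row i sep).2.
  by rewrite rowE K_form_row gapE subr0 eqxx => /esym/forallP/(_ j)/eqP.
have /card_gt0P[i iV2] := V2_gt0; have /eqP := gapE i.
by rewrite iV2 mul1r mulf_eq0 invr_eq0 (negPf V2R_neq0) orbF => /eqP.
Qed.

Lemma lambda_alpha_K_form (G : digraph n) : K_form V1 V2 G -> gap = 0 ->
  lambda_alpha alpha G = rho.
Proof.
move=> formG gap0.
apply: (spectral_radius_eq order_gt0 (alpha_mx_nonneg G) test_vector_gt0).
  have alpha_le1 : 1 - alpha <= 1 by rewrite gerBl.
  have le1 : (1 - alpha) * u <= 1 by rewrite mulr_ile1 ?subr_ge0 // ltW.
  rewrite -addrA -opprD subr_ge0 orderE -addrA.
  apply: le_trans (lerD V1R_ge1 (le_trans le1 V2R_ge1)) _.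
  by rewrite lerDr ler0n.
move=> i; rewrite alpha_mx_row (eq_bigl _ _ (formG i)) K_form_row gap0.
by rewrite mul0r mulr0 subr0.
Qed.

End TestVector.

(** Intermediate value theorem on [0, 1]: the right side minus the left is [k + 1 - n < 0] at 0 and
    [(1 - alpha) * k > 0] at 1. *)
Lemma rate_exists (R : realType) (n k : nat) (alpha : R) :
  0 <= alpha < 1 -> (0 < k)%N -> (k + 1 < n)%N ->
  exists u : R, [/\ 0 < u, u < 1 &
    (n%:R - 1 - (1 - alpha) * u - alpha * k%:R) * (1 - u) = (1 - alpha) * k%:R].
Proof.
move=> /andP[a0 a1] k0 kn.
have k1 : 1 <= k%:R :> R by rewrite ler1n.
have nk : k%:R + 1 < n%:R :> R by rewrite natr1 ltr_nat -addn1.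
pose p : {poly R} := ((1 - alpha) * k%:R)%:P
  - ((n%:R - 1 - alpha * k%:R)%:P - (1 - alpha)%:P * 'X) * (1 - 'X).
have pE u : p.[u] = (1 - alpha) * k%:R
    - (n%:R - 1 - alpha * k%:R - (1 - alpha) * u) * (1 - u).
  by rewrite !hornerE.
have [||u] := @poly_ivt R p 0 1; first exact: ler01.
  by rewrite !pE; apply/andP; split; nra.
move=> /andP[u0 u1] /rootP; rewrite pE => pu0.
exists u; split.
- rewrite lt_neqAle u0 andbT; apply/eqP => u00; rewrite -u00 in pu0; nra.
- rewrite lt_neqAle u1 andbT; apply/eqP => u11; rewrite u11 in pu0; nra.
- lra.
Qed.

(** * The common bound and the extremal digraphs *)

Definition K_partition (n k : nat) (V1 V2 : {set 'I_n}) : Prop :=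
  [/\ [disjoint V1 & V2], (0 < #|V1|)%N, (0 < #|V2|)%N
    & (k + #|V1| + #|V2| = n)%N].

(* The zeros of [(|V2| - 1)(|V1| - 1 + alpha u)], for [u > 0]. *)
Definition extremal_sizes (R : realType) (alpha : R) (n : nat)
    (V1 V2 : {set 'I_n}) : Prop :=
  #|V2| = 1%N \/ alpha = 0 /\ #|V1| = 1%N.

(** The bound [rho] is chosen before the parts: it depends only on [n], [k] and [alpha], so one
    value bounds all the K(n,k,m) and can be compared across different partitions. *)
Lemma extremal_rate (R : realType) (n k : nat) (alpha : R) :
  0 <= alpha < 1 -> (0 < k)%N -> (k + 1 < n)%N ->
  exists rho : R, forall (V1 V2 : {set 'I_n}) (G : digraph n),
    K_partition k V1 V2 ->
    [/\ separation G V1 V2 -> lambda_alpha alpha G <= rho,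
        separation G V1 V2 -> strongly_connected G ->
          lambda_alpha alpha G = rho ->
          K_form V1 V2 G /\ extremal_sizes alpha V1 V2 &
        K_form V1 V2 G -> extremal_sizes alpha V1 V2 ->
          lambda_alpha alpha G = rho].
Proof.
move=> alphaP k0 kn; have [u [u0 u1 uE]] := rate_exists alphaP k0 kn.
have /andP[a0 a1] := alphaP.
exists (n%:R - 1 - (1 - alpha) * u) => V1 V2 G [dis V1_gt0 V2_gt0 cardV].
split.
- exact: (lambda_alpha_separation_le a0 a1 u0 u1 uE dis V1_gt0 V2_gt0 cardV).
- move=> sep conG lamE.
  have [formG gap0] := lambda_alpha_separation_eq a0 a1 u0 u1 uE dis V1_gt0
    V2_gt0 cardV sep conG lamE.
  split=> //; move/eqP: gap0; rewrite mulf_eq0 subr_eq0 pnatr_eq1.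
  case/orP => [/eqP|]; first by left.
  rewrite addr_eq0 => /eqP V1E; right.
  (* The second factor of the gap is a sum of the nonnegative terms [#|V1| - 1] and [alpha * u], so
     both vanish. *)
  have V1_ge1 : 1 <= #|V1|%:R :> R by rewrite ler1n.
  have au0 : 0 <= alpha * u by rewrite mulr_ge0 // ltW.
  have /eqP : alpha * u = 0 by lra.
  rewrite mulf_eq0 (gt_eqF u0) orbF => /eqP alpha0; split=> //.
  by apply/eqP; rewrite -(pnatr_eq1 R); apply/eqP; rewrite alpha0 in V1E; lra.
- move=> formG ext.
  apply: (lambda_alpha_K_form a0 a1 u0 u1 uE dis V1_gt0 V2_gt0 cardV) => //.
  case: ext => [->|[-> ->]]; first by rewrite subrr mul0r.
  by rewrite mul0r addr0 subrr mulr0.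
Qed.

Lemma K_partition_digraphK (n k m : nat) : (0 < m)%N -> (k + m < n)%N ->
  K_partition k (K_V1 n k m) (K_V2 n k m).
Proof.
move=> m0 kmn; split; rewrite ?card_K_V1 ?card_K_V2 ?disjoint_K_V12 //; lia.
Qed.

Lemma K_form_iso_digraphK (n k m : nat) (V1 V2 : {set 'I_n}) (G : digraph n) :
  K_partition k V1 V2 -> K_form V1 V2 G -> #|V1| = m ->
  digraph_iso G (digraphK n k m).
Proof.
move=> [dis V1_gt0 V2_gt0 cardV] formG V1m.
have c1 : #|V1| = #|K_V1 n k m| by rewrite card_K_V1; lia.
have c2 : #|V2| = #|K_V2 n k m| by rewrite card_K_V2; lia.
exact: (K_form_iso dis (disjoint_K_V12 n k m) c1 c2 formG (@K_form_digraphK n k m)).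
Qed.

Lemma iso_digraphK_K_form (n k m : nat) (G : digraph n) :
  (0 < m)%N -> (k + m < n)%N -> digraph_iso G (digraphK n k m) ->
  exists V1 V2 : {set 'I_n}, [/\ K_partition k V1 V2, K_form V1 V2 G,
    #|V1| = m & #|V2| = (n - (k + m))%N].
Proof.
move=> m0 kmn isoG.
have [V1 [V2 [dis c1 c2 formG]]] :=
  iso_K_form (disjoint_K_V12 n k m) isoG (@K_form_digraphK n k m).
rewrite card_K_V1 ?(ltnW kmn) // in c1; rewrite card_K_V2 in c2.
by exists V1, V2; split=> //; split=> //; rewrite ?c1 ?c2 //; lia.
Qed.

Theorem theorem6p2 (R : realType) (n k : nat) (G : digraph n) :
  (1 <= k)%N -> (k <= n - 2)%N ->
  strongly_connected G -> arc_connectivity G = k ->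
  [/\ lambda_alpha (0 : R) G <= lambda_alpha 0 (digraphK n k 1),
      lambda_alpha (0 : R) (digraphK n k 1)
        = lambda_alpha 0 (digraphK n k (n - k - 1)) &
      (lambda_alpha (0 : R) G = lambda_alpha 0 (digraphK n k 1) <->
       digraph_iso G (digraphK n k (n - k - 1)) \/
       digraph_iso G (digraphK n k 1))]
  /\
  (forall alpha : R, 0 < alpha < 1 ->
     lambda_alpha alpha G <= lambda_alpha alpha (digraphK n k (n - k - 1)) /\
     (lambda_alpha alpha G = lambda_alpha alpha (digraphK n k (n - k - 1)) <->
      digraph_iso G (digraphK n k (n - k - 1)))).
Proof.
move=> k0 kn conG Gk.
have [V1 [V2 [dis V1_gt0 V2_gt0 cardV sep]]] :=
  separation_of_arc_connectivity kn ltac:(lia) Gk.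
have part : K_partition k V1 V2 by split.
have kn1 : (k + 1 < n)%N by lia.
have partK1 := @K_partition_digraphK n k 1 isT kn1.
have partKn := @K_partition_digraphK n k (n - k - 1) ltac:(lia) ltac:(lia).
have card1 : #|K_V1 n k 1| = 1%N by rewrite card_K_V1 //; lia.
have cardn : #|K_V2 n k (n - k - 1)| = 1%N by rewrite card_K_V2; lia.
have isoKn : #|V2| = 1%N -> K_form V1 V2 G ->
    digraph_iso G (digraphK n k (n - k - 1)).
  by move=> c2 formG; apply: K_form_iso_digraphK part formG _; lia.
split.
  have alphaP : 0 <= (0 : R) < 1 by rewrite lexx ltr01.
  have [rho rhoP] := extremal_rate alphaP k0 kn1.
  have [le_rho eq_rho _] := rhoP _ _ G part.
  have -> : lambda_alpha 0 (digraphK n k 1) = rho.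
    have [_ _ ->//] := rhoP _ _ (digraphK n k 1) partK1.
    by right.
  have -> : lambda_alpha 0 (digraphK n k (n - k - 1)) = rho.
    have [_ _ ->//] := rhoP _ _ (digraphK n k (n - k - 1)) partKn.
    by left.
  split; [exact: le_rho | by [] |].
  split=> [/(eq_rho sep conG)[formG [c2|[_ c1]]]|[isoG|isoG]].
  - by left; apply: isoKn.
  - by right; apply: K_form_iso_digraphK part formG c1.
  (* The isomorphism provides its own parts of [G], possibly other than [V1] and [V2]; [rho] is the
     same for them. *)
  - have [||W1 [W2 [partW formG _ c2]]] := iso_digraphK_K_form _ _ isoG; try lia.
    by have [_ _ ->//] := rhoP _ _ G partW; left; lia.
  - have [||W1 [W2 [partW formG c1 _]]] := iso_digraphK_K_form _ _ isoG; try lia.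
    by have [_ _ ->//] := rhoP _ _ G partW; right.
move=> alpha /andP[a0 a1].
have alphaP : 0 <= alpha < 1 by rewrite ltW.
have [rho rhoP] := extremal_rate alphaP k0 kn1.
have [le_rho eq_rho _] := rhoP _ _ G part.
have -> : lambda_alpha alpha (digraphK n k (n - k - 1)) = rho.
  have [_ _ ->//] := rhoP _ _ (digraphK n k (n - k - 1)) partKn.
  by left.
split; first exact: le_rho.
split=> [/(eq_rho sep conG)[formG [c2|[alpha0 _]]]|isoG].
- exact: isoKn.
- by rewrite alpha0 ltxx in a0.
have [||W1 [W2 [partW formG _ c2]]] := iso_digraphK_K_form _ _ isoG; try lia.
by have [_ _ ->//] := rhoP _ _ G partW; left; lia.
Qed.
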